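(* Let $\mathcal L$ be a semilattice and $(\mathfrak A,(A_i)_{i\in\mathcal L})$ an $\mathcal L$-graded $C^*$-algebra. Then $\mathfrak A$ is commutative if and only if the component $A_i$ is commutative for every $i\in\mathcal L$.
   Context: A semilattice is a partially ordered set $\mathcal L$ in which any two elements $k,\ell$ have a greatest lower bound $k\wedge\ell$. A $C^*$-algebra $\mathfrak A$ is $\mathcal L$-graded with components $(A_i)_{i\in\mathcal L}$, written $(\mathfrak A,(A_i)_{i\in\mathcal L})$, if $(A_i)_{i\in\mathcal L}$ is a family of sub-$C^*$-algebras of $\mathfrak A$ which is linearly independent (if $S_i\in A_i$, only finitely many $S_i$ are nonzero and $\sum_i S_i=0$, then all $S_i=0$), total (the linear span of $\bigcup_i A_i$ is dense in $\mathfrak A$), and satisfies $A_iA_j\subset A_{i\wedge j}$ for all $i,j\in\mathcal L$. *)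

(* Defs.v *)
From HB Require Import structures.
From mathcomp Require Import all_boot all_order all_algebra.
From mathcomp Require Import complex.
From mathcomp Require Import all_classical all_reals all_analysis.

Set Implicit Arguments.
Unset Strict Implicit.
Unset Printing Implicit Defensive.

Import Order.TTheory GRing.Theory Num.Theory.
Import numFieldNormedType.Exports.

Local Open Scope classical_set_scope.
Local Open Scope ring_scope.
Local Open Scope complex_scope.

(* C*-algebras are complex and not assumed unital, whence a separate product
   rather than the (unital) algebra structures of the algebraic hierarchy.
   The norm is valued in R[i], where 0 <= z forces z to be real. *)
HB.mixin Record isCstarAlgebra (R : realType) A
    of CompleteNormedModule R[i] A := {
  cmul : A -> A -> A;
  cstar : A -> A;
  cmulA : associative cmul;
  cmulDl : left_distributive cmul +%R;
  cmulDr : right_distributive cmul +%R;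
  cmulZl : forall (a : R[i]) (x y : A), cmul (a *: x) y = a *: cmul x y;
  cmulZr : forall (a : R[i]) (x y : A), cmul x (a *: y) = a *: cmul x y;
  cstarK : involutive cstar;
  cstarD : {morph cstar : x y / x + y};
  cstarZ : forall (a : R[i]) (x : A), cstar (a *: x) = Num.conj a *: cstar x;
  cstarM : forall x y : A, cstar (cmul x y) = cmul (cstar y) (cstar x);
  norm_cmul : forall x y : A, `|cmul x y| <= `|x| * `|y|;
  norm_cstar : forall x : A, `|cmul (cstar x) x| = `|x| ^+ 2
}.

#[short(type="cstarAlgType")]
HB.structure Definition CstarAlgebra (R : realType) :=
  {A of isCstarAlgebra R A & CompleteNormedModule R[i] A}.

Record sub_cstar (R : realType) (A : cstarAlgType R) (B : set A) : Prop := {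
  sub_cstar0 : B 0;
  sub_cstarD : forall x y, B x -> B y -> B (x + y);
  sub_cstarZ : forall (a : R[i]) x, B x -> B (a *: x);
  sub_cstarM : forall x y, B x -> B y -> B (cmul x y);
  sub_cstar_star : forall x, B x -> B (cstar x);
  sub_cstar_closed : closed B
}.

Definition linear_span (K : numFieldType) (V : lmodType K) (X : set V) : set V :=
  [set x | exists (n : nat) (c : 'I_n -> K) (v : 'I_n -> V),
     (forall k, X (v k)) /\ x = \sum_(k < n) c k *: v k].

(* The sum over [set: L] denotes the sum over the support of S; it would be 0
   if that support were infinite, so its finiteness is required explicitly. *)
Definition independent_family (L : choiceType) (V : zmodType)
    (B : L -> set V) : Prop :=
  forall S : L -> V, (forall i, B i (S i)) ->
    finite_set [set i | S i != 0] ->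
    \sum_(i \in [set: L]) S i = 0 -> forall i, S i = 0.

Record graded_cstar (R : realType) (d : Order.disp_t)
    (L : meetSemilatticeType d) (A : cstarAlgType R) (B : L -> set A) : Prop := {
  graded_sub : forall i, sub_cstar (B i);
  graded_independent : independent_family B;
  graded_total : dense (linear_span (\bigcup_(i in [set: L]) B i));
  graded_mul : forall i j x y,
    B i x -> B j y -> B (Order.meet i j) (cmul x y)
}.

Definition commutative_on (R : realType) (A : cstarAlgType R) (B : set A) : Prop :=
  forall x y, B x -> B y -> cmul x y = cmul y x.

(* Main.v *)
Require Import Defs.
From mathcomp Require Import all_boot all_order all_algebra.
From mathcomp Require Import all_classical all_reals all_analysis.

(** Only the passage from the components to the whole algebra needs an argument.

    Let [a] lie in [A_i], [b] in [A_j], and let [k] be the meet of [i] and [j].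
    Both [ab] and [ba] lie in [A_k], which is commutative and is stable under
    multiplication by [a] and by [b], on either side. A purely algebraic
    computation shows that an element [a] stabilising such a commutative set
    commutes with every product [zw] of two of its elements
    ([stabilizer_comm_prod]); since [bz] is again in [A_k], this gives
    [a(bz)w = (bz)wa = b(zw)a = ba(zw)], that is, [c(zw) = 0] for the commutator
    [c = ab - ba]. As [c] and [c*] are themselves in [A_k], one may take
    [z = c*] and [w = c], and [c c* c = 0] forces [c = 0] by the C*-identity
    ([cube_eq0]). Hence elements of any two components commute
    ([components_commute]).

    By bilinearity the linear span of the components is commutative, and the
    commutator being continuous in each variable, commutativity passes to
    the closure of that span ([dense_commute]), which is the whole algebra. *)

Set Implicit Arguments.
Unset Strict Implicit.
Unset Printing Implicit Defensive.

Import Order.TTheory GRing.Theory Num.Theory.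
Import numFieldNormedType.Exports.

Local Open Scope classical_set_scope.
Local Open Scope ring_scope.

Section CstarAlgebraTheory.
Variables (R : realType) (A : cstarAlgType R).
Implicit Types (x y z : A) (S : set A).

Lemma cmul0l x : cmul 0 x = 0.
Proof. by rewrite -(scale0r (0 : A)) cmulZl !scale0r. Qed.

Lemma cmul0r x : cmul x 0 = 0.
Proof. by rewrite -(scale0r (0 : A)) cmulZr !scale0r. Qed.

Lemma cmulNl x y : cmul (- x) y = - cmul x y.
Proof. by rewrite -(scaleN1r x) cmulZl -[RHS]scaleN1r. Qed.

Lemma cmulNr x y : cmul x (- y) = - cmul x y.
Proof. by rewrite -(scaleN1r y) cmulZr -[RHS]scaleN1r. Qed.

Lemma cstar_mul_eq0 x : cmul (cstar x) x = 0 -> x = 0.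
Proof.
move=> x0; have := norm_cstar x; rewrite x0 normr0 => /esym/eqP.
by rewrite expf_eq0 /= normr_eq0 => /eqP.
Qed.

(** The self-adjoint element [h = x* x] satisfies [h* h = x* (x x* x) = 0], so
    the C*-identity applies twice. *)
Lemma cube_eq0 x : cmul x (cmul (cstar x) x) = 0 -> x = 0.
Proof.
move=> x0; apply: cstar_mul_eq0; apply: cstar_mul_eq0.
by rewrite cstarM cstarK -cmulA x0 cmul0r.
Qed.

(** Move [a] through the product one commutation in [S] at a time:
    [(az)w = w(az) = (wa)z = z(wa)], and [zw = wz]. *)
Lemma stabilizer_comm_prod S a z w : commutative_on S ->
  (forall s, S s -> S (cmul a s)) -> (forall s, S s -> S (cmul s a)) ->
  S z -> S w -> cmul a (cmul z w) = cmul (cmul z w) a.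
Proof.
move=> Scomm Sl Sr Sz Sw.
rewrite cmulA (Scomm (cmul a z) w) ?cmulA; [|exact: Sl|by []].
by rewrite (Scomm (cmul w a) z) ?cmulA; [|exact: Sr|by []].
Qed.

Lemma commute_linear_span S x y :
  (forall s, S s -> cmul x s = cmul s x) ->
  linear_span S y -> cmul x y = cmul y x.
Proof.
move=> xS [n [c [v [Sv ->]]]].
apply: (big_ind (fun y => cmul x y = cmul y x)) => [|u w xu xw|k _].
- by rewrite cmul0l cmul0r.
- by rewrite cmulDl cmulDr xu xw.
- by rewrite cmulZl cmulZr xS.
Qed.

Lemma norm_commutator x y :
  `|cmul x y - cmul y x| <= (`|x| + `|x|) * `|y|.
Proof.
rewrite (le_trans (ler_normB _ _))// mulrDl lerD ?norm_cmul//.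
by rewrite mulrC norm_cmul.
Qed.

(** The commutator with [x] is linear and bounded, so it vanishes everywhere as
    soon as it vanishes on a dense set. *)
Lemma dense_commute S x : dense S ->
  (forall s, S s -> cmul x s = cmul s x) -> forall y, cmul x y = cmul y x.
Proof.
move=> dS xS y; apply/eqP; rewrite -subr_eq0; apply: contraT => nz.
set e := `|cmul x y - cmul y x|.
have e0 : 0 < e by rewrite normr_gt0.
(* Adding 1 keeps the Lipschitz constant positive even when x = 0. *)
set M := `|x| + `|x| + 1.
have M0 : 0 < M by rewrite ltr_wpDl// addr_ge0.
have eM0 : 0 < e / M by rewrite divr_gt0.
have [s [ys Ss]] : ball y (e / M) `&` S !=set0.
  by apply: dS; [exists y; exact: ballxx|exact: ball_open].
move: ys; rewrite -ball_normE /= ltr_pdivlMr// mulrC => ltMe.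
suff : e < e by rewrite ltxx.
apply: le_lt_trans ltMe.
have -> : e = `|cmul x (y - s) - cmul (y - s) x|.
  congr `|_|; rewrite cmulDl cmulDr cmulNl cmulNr (xS _ Ss).
  by rewrite opprD addrACA subrr addr0.
rewrite (le_trans (norm_commutator _ _))// ler_wpM2r// /M.
by rewrite lerDl.
Qed.

End CstarAlgebraTheory.

(** The component at the meet absorbs both [a] and [b], and contains their
    commutator; this confines the question to a single commutative component. *)
Lemma components_commute (R : realType) (d : Order.disp_t)
    (L : meetSemilatticeType d) (A : cstarAlgType R) (B : L -> set A) :
  graded_cstar B -> (forall i, commutative_on (B i)) ->
  forall i j a b, B i a -> B j b -> cmul a b = cmul b a.
Proof.
move=> [Bsub _ _ Bmul] Bcomm i j a b Ba Bb.
pose k := Order.meet i j.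
have [ik jk] : Order.meet i k = k /\ Order.meet j k = k.
  by rewrite /k meetA meetxx meetCA meetxx.
have al s : B k s -> B k (cmul a s) by move=> /(Bmul _ _ _ _ Ba); rewrite ik.
have ar s : B k s -> B k (cmul s a).
  by move=> /Bmul/(_ Ba); rewrite meetC ik.
have bl s : B k s -> B k (cmul b s) by move=> /(Bmul _ _ _ _ Bb); rewrite jk.
have br s : B k s -> B k (cmul s b).
  by move=> /Bmul/(_ Bb); rewrite meetC jk.
have comm_prod0 z w : B k z -> B k w ->
    cmul (cmul a b - cmul b a) (cmul z w) = 0.
  move=> Bz Bw; apply/eqP; rewrite cmulDl cmulNl subr_eq0; apply/eqP.
  rewrite -!cmulA (stabilizer_comm_prod (Bcomm k) al ar Bz Bw) (cmulA b z w).
  rewrite (stabilizer_comm_prod (Bcomm k) al ar (bl _ Bz) Bw).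
  by rewrite !cmulA.
have Bc : B k (cmul a b - cmul b a).
  apply: (sub_cstarD (Bsub k)); first exact: Bmul.
  rewrite -scaleN1r; apply: (sub_cstarZ (Bsub k)).
  by rewrite /k meetC; exact: Bmul.
apply/eqP; rewrite -subr_eq0; apply/eqP/cube_eq0.
exact: comm_prod0 (sub_cstar_star (Bsub k) Bc) Bc.
Qed.

Theorem proposition5p1p1 (R : realType) (d : Order.disp_t)
    (L : meetSemilatticeType d) (A : cstarAlgType R) (B : L -> set A)
    (hB : graded_cstar B) :
  commutative (@cmul R A) <-> (forall i : L, commutative_on (B i)).
Proof.
split=> [Acomm i x y _ _|Bcomm]; first exact: Acomm.
have comm_component i x : B i x -> forall y, cmul x y = cmul y x.
  move=> Bx; apply: (dense_commute (graded_total hB)) => y.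
  apply: commute_linear_span => s [j _ Bs].
  exact: (components_commute hB Bcomm Bx Bs).
move=> x; apply: (dense_commute (graded_total hB)) => y.
apply: commute_linear_span => s [j _ Bs].
by rewrite (comm_component j s).
Qed.
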